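(* Let $A\in\mathbb{R}^{m\times n}$ with $m\ge n$, with singular values $\sigma_1(A)\ge\sigma_2(A)\ge\cdots\ge\sigma_n(A)\ge 0$, and let $V_{\mathsf{opt}}\in\mathbb{R}^{n\times r}$ be a matrix whose columns are orthonormal right singular vectors belonging to $r$ largest singular values of $A$. Then the random index set $J$ returned by Adaptive Randomized Pivoting (ARP) applied to $V=V_{\mathsf{opt}}$ satisfies $$\mathbb{E}[\|A-\Pi_J A\|_F^2]\le \mathbb{E}[\|A-A(:,J)V_{\mathsf{opt}}(J,:)^{-T}V_{\mathsf{opt}}^T\|_F^2]\le (r+1)\big(\sigma_{r+1}^2(A)+\cdots+\sigma_n^2(A)\big),$$ where $\Pi_J$ denotes the orthogonal projector onto the column space of $A(:,J)$.
   Context: $\|\cdot\|_F$ is the Frobenius norm. For an index tuple $J$, $A(:,J)$ denotes the columns of $A$ indexed by $J$, $V(J,:)$ the rows of $V$ indexed by $J$, and $V(J,:)^{-T}$ is the inverse transpose of $V(J,:)$. Adaptive Randomized Pivoting (ARP). Input: $V\in\mathbb{R}^{n\times r}$ with orthonormal columns. Set $W_0=V$. For $k=1,\ldots,r$: set $p_j=\|W_{k-1}(j,k:r)\|_2^2/(r-k+1)$ for $j=1,\ldots,n$ (a probability distribution on $\{1,\dots,n\}$), where $W_{k-1}(j,k:r)$ is row $j$ restricted to columns $k,\ldots,r$; sample $j_k$ according to the probabilities $p_j$; set $W_k=W_{k-1}Q_k$, where $Q_k=\mathrm{diag}(\mathrm{Id}_{k-1},H_k)\in\mathbb{R}^{r\times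 r}$ and $H_k\in\mathbb{R}^{(r-k+1)\times(r-k+1)}$ is a Householder reflector $\mathrm{Id}-2u_ku_k^T$ with a unit vector $u_k$ (or the identity, if there is nothing to annihilate), chosen such that $W_{k-1}(j_k,k:r)H_k$ is a multiple of the first unit row vector, i.e. $W_k(j_k,k+1:r)=0$. Output: $J=(j_1,\ldots,j_r)$. With probability one, the indices are distinct and $V(J,:)$ is invertible. *)

(* Defs.v *)
From HB Require Import structures.
From mathcomp Require Import all_boot all_order all_algebra.
From mathcomp Require Import reals.

Set Implicit Arguments.
Unset Strict Implicit.
Unset Printing Implicit Defensive.

Import Order.TTheory GRing.Theory Num.Theory.

Local Open Scope ring_scope.

Definition frobenius_norm (R : realType) (m n : nat) (A : 'M[R]_(m, n)) : R :=
  Num.sqrt (\sum_(i < m) \sum_(j < n) A i j ^+ 2).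

Definition orthonormal_cols (R : realType) (m n : nat) (A : 'M[R]_(m, n)) :=
  A^T *m A = 1%:M.

(* [s] lists the singular values of [A] in nonincreasing order: they are the
   diagonal of a thin singular value decomposition of [A].  Such a
   decomposition, with [n] singular values, exists exactly when [n <= m]. *)
Definition singular_values (R : realType) (m n : nat) (A : 'M[R]_(m, n))
    (s : 'I_n -> R) :=
  [/\ forall i, 0 <= s i,
      forall i j : 'I_n, (i <= j)%N -> s j <= s i
    & exists (U : 'M[R]_(m, n)) (V : 'M[R]_n),
        [/\ orthonormal_cols U, orthonormal_cols V
          & A = U *m diag_mx (\row_i s i) *m V^T]].

Definition right_singular_vector (R : realType) (m n : nat) (A : 'M[R]_(m, n))
    (sigma : R) (v : 'cV[R]_n) :=
  v^T *m v = 1%:M /\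
  exists u : 'cV[R]_m,
    [/\ u^T *m u = 1%:M, A *m v = sigma *: u & A^T *m u = sigma *: v].

(* The injection [f] has image [{i | i < r}], so the columns of [V] are matched
   one to one, in any order, with the [r] largest singular values; this
   forces [r <= n]. *)
Definition leading_right_singular_vectors (R : realType) (m n r : nat)
    (A : 'M[R]_(m, n)) (s : 'I_n -> R) (V : 'M[R]_(n, r)) :=
  orthonormal_cols V /\
  exists f : 'I_r -> 'I_n,
    [/\ injective f, forall k, (f k < r)%N
      & forall k, right_singular_vector A (s (f k)) (col k V)].

(* [P] is symmetric and idempotent, with the same column space as [B]. *)
Definition orthogonal_projector (R : realType) (m q : nat) (B : 'M[R]_(m, q))
    (P : 'M[R]_m) :=
  [/\ P^T = P, P *m P = P & (P^T == B^T)%MS].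

(* diag(Id_k, Id - 2 u u^T) for a unit vector [u] of size [r - k]: the vector
   [u] is padded with [k] leading zeros. *)
Definition trailing_reflector (R : realType) (r k : nat) (Q : 'M[R]_r) :=
  exists u : 'cV[R]_r,
    [/\ u^T *m u = 1%:M, forall l : 'I_r, (l < k)%N -> u l 0 = 0
      & Q = 1%:M - 2%:R *: (u *m u^T)].

(* Steps and columns are numbered from 0: step [k] samples with the row norms
   over the columns [k, ..., r - 1]. *)
Definition arp_pick_prob (R : realType) (n r k : nat) (W : 'M[R]_(n, r))
    (j : 'I_n) : R :=
  (\sum_(l < r | (k <= l)%N) W j l ^+ 2) / (r - k)%:R.

Definition arp_update (R : realType) (n r k : nat) (W : 'M[R]_(n, r))
    (j : 'I_n) (W' : 'M[R]_(n, r)) :=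
  exists Q : 'M[R]_r,
    [/\ trailing_reflector k Q \/ Q = 1%:M, W' = W *m Q
      & forall l : 'I_r, (k < l)%N -> W' j l = 0].

(* [W h] is the working matrix once the indices [h] have been sampled, in this
   order.  The reflector at each step is not unique; [W] records an arbitrary
   admissible choice, which may depend on all past samples. *)
Definition arp_run (R : realType) (n r : nat) (V : 'M[R]_(n, r))
    (W : seq 'I_n -> 'M[R]_(n, r)) :=
  W [::] = V /\
  forall (h : seq 'I_n) (j : 'I_n), (size h < r)%N ->
    arp_update (size h) (W h) j (W (rcons h j)).

(* Law of the output: product of the conditional sampling probabilities. *)
Definition arp_prob (R : realType) (n r : nat) (W : seq 'I_n -> 'M[R]_(n, r))
    (J : r.-tuple 'I_n) : R :=
  \prod_(k < r) arp_pick_prob k (W (take k J)) (tnth J k).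

Definition arp_expectation (R : realType) (n r : nat)
    (W : seq 'I_n -> 'M[R]_(n, r)) (X : r.-tuple 'I_n -> R) : R :=
  \sum_(J : r.-tuple 'I_n) arp_prob W J * X J.

(* Main.v *)
(* ARP is volume sampling: whatever reflectors are used, the output is [J] with
   probability [det(V_J)^2 / r!].  The first bound then holds for each [J], as
   [Pi_J A] is the best approximation of [A] with columns in the span of
   [A_J].  For the second one put [E = A - A V V^T]; the error splits
   orthogonally into [E] and [E_J V_J^-T V^T].  After multiplication by
   [det(V_J)], the entries of [E_J V_J^-T] are, by Cramer's rule, [r x r] minors
   of [V] with one column replaced by a row of [E], and Cauchy-Binet sums their
   squares over [J] to [r! r |E|^2].  Finally [|E|^2] is the sum of the
   [s_i^2] over [i >= r]. *)
Require Import Defs.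
From HB Require Import structures.
From mathcomp Require Import all_boot all_order all_algebra.
From mathcomp Require Import fingroup perm.
From mathcomp Require Import reals.

Set Implicit Arguments.
Unset Strict Implicit.
Unset Printing Implicit Defensive.

Import Order.TTheory GRing.Theory Num.Theory.

Local Open Scope ring_scope.

(** * Cauchy-Binet formula over all index tuples *)

Section CauchyBinet.
Variables (R : comPzRingType) (n r : nat).
Implicit Types M N : 'M[R]_(n, r).

(** Multilinearity in the rows: row [a] of [M^T *m N] combines the rows of [N] with coefficients
    from column [a] of [M]. *)
Lemma det_trmx_mul_sum M N :
  \det (M^T *m N)
    = \sum_(f : {ffun 'I_r -> 'I_n}) (\prod_a M (f a) a) * \det (rowsub f N).
Proof.
under eq_bigr do rewrite mulr_sumr.
rewrite exchange_big /=; apply: eq_bigr => t _.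
under eq_bigr => a _ do rewrite mxE.
rewrite bigA_distr_bigA mulr_sumr; apply: eq_bigr => f _.
rewrite mulrCA -big_split /=; congr (_ * _).
by apply: eq_bigr => a _; rewrite !mxE.
Qed.

Lemma Cauchy_Binet_ffun M N :
  \sum_(f : {ffun 'I_r -> 'I_n}) \det (rowsub f M) * \det (rowsub f N)
    = r`!%:R * \det (M^T *m N).
Proof.
under eq_bigr do rewrite {1}/determinant mulr_suml.
rewrite exchange_big /=.
transitivity (\sum_(t : 'S_r) \det (M^T *m N)); last first.
  by rewrite sumr_const mulr_natl card_Sn.
apply: eq_bigr => t _; rewrite det_trmx_mul_sum.
(* Precomposing with [t] permutes the rows of the second minor; the resulting sign cancels that of
   the Leibniz term. *)
rewrite (reindex (fun g : {ffun 'I_r -> 'I_n} => [ffun a => g (t a)])); last first.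
  exists (fun g : {ffun 'I_r -> 'I_n} => [ffun a => g (t^-1%g a)]) => g _;
    by apply/ffunP => a; rewrite !ffunE ?permK ?permKV.
apply: eq_bigr => g _.
have -> : rowsub [ffun a => g (t a)] N = row_perm t (rowsub g N).
  by apply/matrixP => a b; rewrite !mxE ffunE.
rewrite row_permE det_mulmx det_perm.
rewrite mulr_signM addbb mul1r; congr (_ * _).
rewrite [RHS](reindex_inj (@perm_inj _ t)); apply: eq_bigr => a _.
by rewrite !mxE ffunE.
Qed.

Lemma Cauchy_Binet M N :
  \sum_(J : r.-tuple 'I_n) \det (rowsub (tnth J) M) * \det (rowsub (tnth J) N)
    = r`!%:R * \det (M^T *m N).
Proof.
rewrite -Cauchy_Binet_ffun.
rewrite (reindex (fun f : {ffun 'I_r -> 'I_n} => [tuple f i | i < r])) /=.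
  apply: eq_bigr => f _; congr (_ * _); congr (\det _);
    by apply/matrixP => a b; rewrite !mxE tnth_mktuple.
exists (fun J : r.-tuple 'I_n => [ffun i => tnth J i]) => J _.
  by apply/ffunP => a; rewrite ffunE tnth_mktuple.
by apply: eq_from_tnth => a; rewrite tnth_mktuple ffunE.
Qed.

End CauchyBinet.

(** * Frobenius norm, projections and singular values *)

Section FrobeniusNorm.
Variable R : realType.

Lemma frobenius_norm_sqr m n (A : 'M[R]_(m, n)) :
  frobenius_norm A ^+ 2 = \sum_(i < m) \sum_(j < n) A i j ^+ 2.
Proof.
by rewrite sqr_sqrtr //; do 2!apply: sumr_ge0 => ? _; rewrite sqr_ge0.
Qed.

Lemma frobenius_norm_sqr_tr m n (A : 'M[R]_(m, n)) :
  frobenius_norm A ^+ 2 = \tr (A *m A^T).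
Proof.
rewrite frobenius_norm_sqr; apply: eq_bigr => i _; rewrite mxE.
by apply: eq_bigr => j _; rewrite mxE expr2.
Qed.

Lemma frobenius_norm_trmx m n (A : 'M[R]_(m, n)) :
  frobenius_norm A^T = frobenius_norm A.
Proof.
rewrite /frobenius_norm exchange_big; congr (Num.sqrt _).
by do 2!apply: eq_bigr => ? _; rewrite mxE.
Qed.

Lemma frobenius_normN m n (A : 'M[R]_(m, n)) :
  frobenius_norm (- A) = frobenius_norm A.
Proof.
by congr (Num.sqrt _); do 2!apply: eq_bigr => ? _; rewrite mxE sqrrN.
Qed.

Lemma frobenius_norm_Pythagoras m n (A B : 'M[R]_(m, n)) :
  A *m B^T = 0 ->
  frobenius_norm (A + B) ^+ 2 = frobenius_norm A ^+ 2 + frobenius_norm B ^+ 2.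
Proof.
move=> AB0; have BA0 : B *m A^T = 0 by rewrite -(trmxK B) -trmx_mul AB0 trmx0.
by rewrite !frobenius_norm_sqr_tr linearD /= mulmxDl !mulmxDr AB0 BA0 addr0
  add0r linearD.
Qed.

Lemma frobenius_norm_mul_orthonormal m n r (F : 'M[R]_(m, r)) (V : 'M[R]_(n, r)) :
  orthonormal_cols V -> frobenius_norm (F *m V^T) = frobenius_norm F.
Proof.
move=> oV; apply/eqP; rewrite -(eqrXn2 (n := 2)) ?sqrtr_ge0 //; apply/eqP.
by rewrite !frobenius_norm_sqr_tr trmx_mul trmxK mulmxA -(mulmxA F) oV mulmx1.
Qed.

(** As [P *m B = B], the residual [Y = A - B *m X] satisfies [A - P *m A = Y - P *m Y], and removing
    the component [P *m Y] cannot increase the norm. *)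
Lemma frobenius_norm_proj_le m n q (A : 'M[R]_(m, n)) (B : 'M[R]_(m, q))
    (P : 'M[R]_m) (X : 'M[R]_(q, n)) :
  orthogonal_projector B P ->
  frobenius_norm (A - P *m A) ^+ 2 <= frobenius_norm (A - B *m X) ^+ 2.
Proof.
case=> symP idP /andP[_ /submxP[Z BZ]].
have BE : B = P *m Z^T by rewrite -[LHS]trmxK BZ trmx_mul trmxK.
have PB : P *m B = B by rewrite BE mulmxA idP.
set Y := A - B *m X.
have -> : A - P *m A = Y - P *m Y.
  by rewrite mulmxBr mulmxA PB opprB addrA subrK.
(* Here the column spaces are orthogonal, whereas the Pythagoras lemma is about row spaces; hence
   the transposes. *)
rewrite -[Y in leRHS](subrK (P *m Y)) -!(frobenius_norm_trmx (_ + _)).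
rewrite [X in _ <= frobenius_norm X ^+ 2]linearD /=.
rewrite frobenius_norm_Pythagoras ?lerDl ?sqr_ge0 // trmxK.
by rewrite linearB /= trmx_mul symP mulmxBl !mulmxA -(mulmxA _ P P) idP subrr.
Qed.

Lemma compl_mul_orthonormal m n r (A : 'M[R]_(m, n)) (V : 'M[R]_(n, r)) :
  orthonormal_cols V -> (A - A *m V *m V^T) *m V = 0.
Proof.
by move=> oV; rewrite mulmxBl -[A *m V *m V^T *m V]mulmxA oV mulmx1 subrr.
Qed.

Lemma frobenius_norm_compl_sqr m n r (A : 'M[R]_(m, n)) (V : 'M[R]_(n, r)) :
  orthonormal_cols V ->
  frobenius_norm (A - A *m V *m V^T) ^+ 2
    = frobenius_norm A ^+ 2 - frobenius_norm (A *m V) ^+ 2.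
Proof.
move=> oV; have orth : (A - A *m V *m V^T) *m (A *m V *m V^T)^T = 0.
  by rewrite trmx_mul trmxK mulmxA compl_mul_orthonormal ?mul0mx.
have := frobenius_norm_Pythagoras orth.
by rewrite subrK frobenius_norm_mul_orthonormal // => ->; rewrite addrK.
Qed.

Lemma singular_values_norm_sqr m n (A : 'M[R]_(m, n)) (s : 'I_n -> R) :
  singular_values A s -> frobenius_norm A ^+ 2 = \sum_i s i ^+ 2.
Proof.
case=> _ _ [U [V [oU oV ->]]].
rewrite frobenius_norm_mul_orthonormal // -frobenius_norm_trmx trmx_mul.
rewrite -[U^T]trmxK trmxK frobenius_norm_mul_orthonormal //.
rewrite tr_diag_mx frobenius_norm_sqr_tr tr_diag_mx mulmx_diag mxtrace_diag.
by apply: eq_bigr => i _; rewrite !mxE expr2.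
Qed.

Lemma leading_right_singular_vectors_norm_sqr m n r (A : 'M[R]_(m, n))
    (s : 'I_n -> R) (V : 'M[R]_(n, r)) :
  leading_right_singular_vectors A s V ->
  frobenius_norm (A *m V) ^+ 2 = \sum_(i < n | (i < r)%N) s i ^+ 2.
Proof.
case=> oV [f [injf fr Hf]].
transitivity (\sum_(k < r) s (f k) ^+ 2).
  rewrite frobenius_norm_sqr exchange_big /=; apply: eq_bigr => k _.
  have [_ [u [u1 Au _]]] := Hf k.
  have /matrixP/(_ 0 0) := u1; rewrite !mxE eqxx mulr1n => {}u1.
  rewrite -[RHS]mulr1 -u1 mulr_sumr; apply: eq_bigr => i _.
  have -> : (A *m V) i k = (A *m col k V) i 0.
    by rewrite !mxE; apply: eq_bigr => j _; rewrite mxE.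
  by rewrite Au !mxE exprMn -expr2.
(* An injective image of ['I_r] inside a set of at most [r] indices fills it. *)
have imf : [set f k | k in 'I_r] = [set i : 'I_n | (i < r)%N].
  apply/eqP; rewrite eqEcard; apply/andP; split.
    by apply/subsetP => _ /imsetP[k _ ->]; rewrite inE.
  rewrite card_imset // card_ord cardE -(size_map val) -[leqRHS](size_iota 0).
  apply: uniq_leq_size; first by rewrite (map_inj_uniq val_inj) enum_uniq.
  by move=> i /mapP[j]; rewrite mem_enum inE mem_iota => jr ->.
rewrite -(big_imset (fun i => s i ^+ 2) (in2W injf)) /=.
by under eq_bigl do rewrite imf inE.
Qed.

End FrobeniusNorm.

(** * Error of the cross approximation *)

Section CrossApproximation.
Variables (R : realType) (n r : nat) (V : 'M[R]_(n, r)).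
Hypothesis oV : orthonormal_cols V.

(* If [V_J] is invertible then the error is [E - E_J V_J^-T V^T] where
   [E = A - A V V^T], and the two terms are orthogonal because [E V = 0]. *)
Lemma cross_approximation_error m (A E : 'M[R]_(m, n)) (J : 'I_r -> 'I_n) :
  E = A - A *m V *m V^T ->
  \det (rowsub J V) ^+ 2 *
    frobenius_norm (A - colsub J A *m (invmx (rowsub J V))^T *m V^T) ^+ 2
  <= \det (rowsub J V) ^+ 2 * frobenius_norm E ^+ 2
     + frobenius_norm (colsub J E *m (\adj (rowsub J V))^T) ^+ 2.
Proof.
(* For singular [V_J], [invmx] returns [V_J] itself, but the weight [\det (rowsub J V) ^+ 2] cancels
   that term. *)
move=> defE; have [d0|dn0] := eqVneq (\det (rowsub J V)) 0.
  by rewrite d0 expr0n !mul0r add0r sqr_ge0.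
set D := invmx _; have uV : rowsub J V \in unitmx by rewrite unitmxE unitfE.
have EV : E *m V = 0 by rewrite defE compl_mul_orthonormal.
have -> : A - colsub J A *m D^T *m V^T = E + - (colsub J E *m D^T *m V^T).
  have -> : colsub J E = colsub J A - A *m V *m (rowsub J V)^T.
    rewrite defE trmx_mxsub mulmx_colsub.
    by apply/matrixP => i j; rewrite !mxE.
  rewrite !mulmxBl -(mulmxA (A *m V)) -trmx_mul mulVmx // trmx1 mulmx1.
  by rewrite opprB addrA defE subrK.
rewrite frobenius_norm_Pythagoras; last first.
  by rewrite linearN /= mulmxN trmx_mul trmxK mulmxA EV mul0mx oppr0.
rewrite frobenius_normN frobenius_norm_mul_orthonormal // mulrDr lerD2l.
have -> : \adj (rowsub J V) = \det (rowsub J V) *: D.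
  by rewrite /D /invmx uV scalerA divff ?scale1r.
rewrite linearZ /= -scalemxAr !frobenius_norm_sqr mulr_sumr.
apply: ler_sum => i _; rewrite mulr_sumr; apply: ler_sum => j _.
by rewrite [in leRHS]mxE exprMn.
Qed.

(* By Cramer, the entries of [E_J adj(V_J)^T] are minors of [V] with one column
   replaced by a row of [E], whose Gram matrix is diagonal as [E V = 0]. *)
Lemma sum_frobenius_norm_adj m (E : 'M[R]_(m, n)) :
  E *m V = 0 ->
  \sum_(J : r.-tuple 'I_n)
      frobenius_norm (colsub (tnth J) E *m (\adj (rowsub (tnth J) V))^T) ^+ 2
    = r`!%:R * (r%:R * frobenius_norm E ^+ 2).
Proof.
move=> EV.
pose M (i : 'I_m) (l : 'I_r) : 'M[R]_(n, r) :=
  \matrix_(a, b) (if b == l then E i a else V a b).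
have detM (J : r.-tuple 'I_n) i l :
    (colsub (tnth J) E *m (\adj (rowsub (tnth J) V))^T) i l
      = \det (rowsub (tnth J) (M i l)).
  (* The cofactors along column [l] do not see the replaced column, so they are those of [V_J]. *)
  rewrite (expand_det_col _ l) mxE; apply: eq_bigr => k _.
  rewrite !mxE eqxx; congr (_ * (_ * \det _)).
  by apply/matrixP => a b; rewrite !mxE eq_sym (negbTE (neq_lift _ _)).
have gramM i l : \det ((M i l)^T *m M i l) = \sum_(a < n) E i a ^+ 2.
  have -> : (M i l)^T *m M i l
      = diag_mx (\row_b if b == l then \sum_(a < n) E i a ^+ 2 else 1).
    have EV0 b : \sum_a E i a * V a b = 0.
      by have /matrixP/(_ i b) := EV; rewrite !mxE.
    apply/matrixP => b c; rewrite !mxE; under eq_bigr do rewrite !mxE.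
    have [/eqP ->|bl] := boolP (b == l); have [/eqP ->|cl] := boolP (c == l).
    - by rewrite eqxx mulr1n; apply: eq_bigr => a _; rewrite expr2.
    - by rewrite EV0 eq_sym (negbTE cl) mulr0n.
    - by rewrite (negbTE bl) mulr0n -[RHS](EV0 b); apply: eq_bigr => a _; rewrite mulrC.
    - have /matrixP/(_ b c) := oV; rewrite !mxE => <-.
      by apply: eq_bigr => a _; rewrite mxE.
  rewrite det_diag (bigD1 l) //= mxE eqxx [X in _ * X]big1 ?mulr1 // => b bl.
  by rewrite mxE (negbTE bl).
under eq_bigr => J _.
  rewrite frobenius_norm_sqr; under eq_bigr do under eq_bigr do rewrite detM.
  over.
rewrite exchange_big /=; under eq_bigr do rewrite exchange_big /=.
under eq_bigr do under eq_bigr do rewrite Cauchy_Binet gramM.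
rewrite frobenius_norm_sqr mulrCA !mulr_sumr; apply: eq_bigr => i _.
by rewrite sumr_const card_ord [RHS]mulr_natl.
Qed.

End CrossApproximation.

(** * Law of the indices sampled by ARP *)

Section AdaptiveRandomizedPivoting.
Variables (R : realType) (n r : nat).

(** These facts hold for any admissible reflector: it is symmetric and involutive, its vector [u]
    starts with [k] zeros, and a row vanishing from column [k] on is orthogonal to [u]. *)
Lemma arp_updateP k (W W' : 'M[R]_(n, r)) (j : 'I_n) :
  arp_update k W j W' ->
  [/\ W' *m W'^T = W *m W^T,
      forall i (l : 'I_r), (l < k)%N -> W' i l = W i l,
      forall i, (forall l : 'I_r, (k <= l)%N -> W i l = 0) -> W' i =1 W i
    & forall l : 'I_r, (k < l)%N -> W' j l = 0].
Proof.
case=> Q [HQ -> W'0]; case: HQ W'0 => [[u [u1 u0 ->]]|->] W'0; last first.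
  by move: W'0; rewrite mulmx1; split.
have WQ i l : (W *m (1%:M - 2%:R *: (u *m u^T))) i l
    = W i l - 2%:R * ((\sum_a W i a * u a 0) * u l 0).
  rewrite mulmxBr mulmx1 -scalemxAr mulmxA.
  by rewrite mxE [X in _ + X]mxE [X in _ - X]mxE [X in _ - _ * X]mxE big_ord1 !mxE.
split=> //.
- set P := u *m u^T; have PP : P *m P = P by rewrite mulmxA -(mulmxA u) u1 mulmx1.
  have -> : (W *m (1%:M - 2%:R *: P))^T = (1%:M - 2%:R *: P) *m W^T.
    by rewrite trmx_mul linearB linearZ /= trmx1 trmx_mul trmxK.
  rewrite mulmxA -(mulmxA W); congr (_ *m _); rewrite -[RHS]mulmx1; congr (_ *m _).
  rewrite mulmxBr mulmx1 mulmxBl mul1mx -scalemxAr -scalemxAl PP opprB scalerA.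
  by rewrite -scalerBl -natrM -natrB // subrK.
- by move=> i l lk; rewrite WQ u0 // !mulr0 subr0.
- move=> i Wi0 l; rewrite WQ big1 ?mul0r ?mulr0 ?subr0 // => a _.
  by have [ak|ka] := ltnP a k; [rewrite u0 ?mulr0 | rewrite Wi0 ?mul0r].
Qed.

(* The rows picked so far stay fixed, so the picked rows of the last working
   matrix form a triangular matrix; its diagonal entries are the sampling
   weights, while its Gram matrix is that of the picked rows of [w 0]. *)
Lemma arp_weights_det (w : nat -> 'M[R]_(n, r)) (j : 'I_r -> 'I_n) :
  (forall k : 'I_r, arp_update k (w k) (j k) (w k.+1)) ->
  \prod_(k < r) \sum_(l < r | (k <= l)%N) w k (j k) l ^+ 2
    = \det (rowsub j (w 0)) ^+ 2.
Proof.
move=> Hw.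
have gram k : (k <= r)%N -> w k *m (w k)^T = w 0 *m (w 0)^T.
  elim: k => // k IH kr; rewrite -IH ?(ltnW kr) //.
  by have [] := arp_updateP (Hw (Ordinal kr)).
have next0 (i l : 'I_r) : (i < l)%N -> w i.+1 (j i) l = 0.
  by have [_ _ _] := arp_updateP (Hw i); apply.
(* After step [i], row [j i] vanishes beyond column [i], so later reflectors leave it unchanged. *)
have fixed (i : 'I_r) k : (i < k <= r)%N -> w k (j i) =1 w i.+1 (j i).
  elim: k => // k IH /andP[]; rewrite ltnS leq_eqVlt => /predU1P[<- //|ik] kr l.
  have wk : w k (j i) =1 w i.+1 (j i) by apply: IH; rewrite ik ltnW.
  have [_ _ /(_ (j i)) fix_row _] := arp_updateP (Hw (Ordinal kr)).
  rewrite fix_row ?wk // => a ka.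
  by rewrite wk next0 // (leq_trans ik).
have lastE (i l : 'I_r) : rowsub j (w r) i l = w i.+1 (j i) l.
  by rewrite mxE fixed // ltn_ord leqnn.
have detE (k : nat) : \det (rowsub j (w k)) ^+ 2
    = \det (mxsub j j (w k *m (w k)^T)).
  by rewrite mxsub_mul -trmx_mxsub det_mulmx det_tr expr2.
rewrite detE -(gram r) // -detE det_trig; last first.
  by apply/is_trig_mxP => i l il; rewrite lastE next0.
rewrite -prodrXl; apply: eq_bigr => i _; rewrite lastE.
(* Step [i] preserves the norm of row [j i] and its first [i] entries, hence also its trailing norm,
   which is then carried by the diagonal entry alone. *)
have [/matrixP/(_ (j i) (j i)) + prefix _ _] := arp_updateP (Hw i).
rewrite !mxE (bigID (fun l : 'I_r => (i <= l)%N)).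
rewrite [in RHS](bigID (fun l : 'I_r => (i <= l)%N)) /=.
under [X in _ + X = _]eq_bigr => l.
  rewrite -ltnNge => li; rewrite mxE prefix //; over.
under [X in _ = _ + X]eq_bigr do rewrite mxE.
move/addIr => H.
transitivity (\sum_(l < r | (i <= l)%N) w i.+1 (j i) l ^+ 2).
  move: H; under eq_bigr do rewrite mxE -expr2.
  by under [RHS]eq_bigr do rewrite mxE -expr2.
rewrite (bigD1 i) //= big1 ?addr0 // => l /andP[il li].
by rewrite next0 ?expr0n // ltn_neqAle eq_sym li il.
Qed.

Lemma arp_probE (V : 'M[R]_(n, r)) (W : seq 'I_n -> 'M[R]_(n, r))
    (J : r.-tuple 'I_n) :
  arp_run V W -> arp_prob W J = \det (rowsub (tnth J) V) ^+ 2 / r`!%:R.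
Proof.
case=> <- HW; rewrite /arp_prob /arp_pick_prob prodf_div; congr (_ / _).
  rewrite (arp_weights_det (w := fun k => W (take k J))) ?take0 // => k.
  have kJ : (k < size J)%N by rewrite size_tuple.
  rewrite (take_nth (tnth J k)) // -tnth_nth.
  have sk : size (take k J) = k by rewrite size_takel // ltnW.
  by have := HW (take k J) (tnth J k); rewrite sk; apply.
by rewrite -natr_prod -ffactnn ffact_prod.
Qed.

End AdaptiveRandomizedPivoting.

Theorem corollary2p5 (R : realType) (m n r : nat) (A : 'M[R]_(m, n))
    (s : 'I_n -> R) (Vopt : 'M[R]_(n, r)) (W : seq 'I_n -> 'M[R]_(n, r))
    (Pi : r.-tuple 'I_n -> 'M[R]_m) :
  (n <= m)%N ->
  singular_values A s ->
  leading_right_singular_vectors A s Vopt ->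
  arp_run Vopt W ->
  (forall J : r.-tuple 'I_n,
     orthogonal_projector (colsub (tnth J) A) (Pi J)) ->
  arp_expectation W (fun J => frobenius_norm (A - Pi J *m A) ^+ 2)
    <= arp_expectation W (fun J =>
         frobenius_norm
           (A - colsub (tnth J) A *m (invmx (rowsub (tnth J) Vopt))^T
                *m Vopt^T) ^+ 2)
    <= r.+1%:R * \sum_(i < n | (r <= i)%N) s i ^+ 2.
Proof.
move=> _ sA lsv run projPi; have [oV _] := lsv.
apply/andP; split.
  apply: ler_sum => J _; rewrite (arp_probE _ run).
  apply: ler_wpM2l; first by rewrite divr_ge0 ?sqr_ge0 ?ler0n.
  by rewrite -mulmxA; exact: frobenius_norm_proj_le.
set E := A - A *m Vopt *m Vopt^T.
have EV : E *m Vopt = 0 by exact: compl_mul_orthonormal.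
(* The full sum of the [s i ^+ 2] is the squared norm of [A], and its first [r] terms give that of
   [A *m Vopt]. *)
have -> : \sum_(i < n | (r <= i)%N) s i ^+ 2 = frobenius_norm E ^+ 2.
  rewrite frobenius_norm_compl_sqr // (singular_values_norm_sqr sA).
  rewrite (leading_right_singular_vectors_norm_sqr lsv).
  rewrite [X in _ = X - _](bigID (fun i : 'I_n => (i < r)%N)) /=.
  rewrite addrAC subrr add0r.
  by apply: eq_bigl => i; rewrite -leqNgt.
rewrite /arp_expectation; under eq_bigr do rewrite (arp_probE _ run) mulrAC.
rewrite -mulr_suml ler_pdivrMr ?ltr0n ?fact_gt0 //.
apply: le_trans.
  apply: ler_sum => J _; exact: (cross_approximation_error oV (tnth J) (erefl E)).
rewrite big_split /= -mulr_suml sum_frobenius_norm_adj //.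
under eq_bigr do rewrite expr2.
by rewrite Cauchy_Binet oV det1 mulr1 -mulrDr -[r.+1%:R]nat1r mulrDl mul1r mulrC.
Qed.
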